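(* Let $\mathcal X$ be a finite set, let $q_{t-1},p_{\mathrm{pref}}\in\Delta(\mathcal X)$ both have full support (i.e. $q_{t-1}(x)>0$ and $p_{\mathrm{pref}}(x)>0$ for all $x\in\mathcal X$), and let $\lambda>0$. Then the solution $q_t^\star$ of the minimization problem $$q_t^\star=\underset{q\in\Delta(\mathcal X)}{\arg\min}\ \left\{H(q\|p_{\mathrm{pref}})+\lambda D_{\mathrm{KL}}(q\|q_{t-1})\right\}$$ is given, for every $x\in\mathcal X$, by $$q_t^\star(x)=\frac{q_{t-1}(x)\,p_{\mathrm{pref}}(x)^{1/\lambda}}{\sum_{y\in\mathcal X}q_{t-1}(y)\,p_{\mathrm{pref}}(y)^{1/\lambda}}.$$
   Context: $\Delta(\mathcal X)=\{q\in\mathbb R_{\ge0}^{|\mathcal X|}:\sum_{x\in\mathcal X}q(x)=1\}$ is the probability simplex on the finite set $\mathcal X$. The cross-entropy is $H(q\|p)=-\sum_{x\in\mathcal X}q(x)\log p(x)$ and the Kullback--Leibler divergence is $D_{\mathrm{KL}}(q\|p)=\sum_{x\in\mathcal X}q(x)\log\frac{q(x)}{p(x)}$, with natural logarithm and the convention $0\log 0=0$. *)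

(* Defs.v *)
From HB Require Import structures.
From mathcomp Require Import all_boot all_order all_algebra.
From mathcomp Require Import all_classical all_reals all_analysis.

Set Implicit Arguments.
Unset Strict Implicit.
Unset Printing Implicit Defensive.

Import Order.TTheory GRing.Theory Num.Theory.
Local Open Scope classical_set_scope.
Local Open Scope ring_scope.

Definition simplex (R : realType) (X : finType) : set {ffun X -> R} :=
  [set q : {ffun X -> R} | (forall x, 0 <= q x) /\ \sum_x q x = 1].
Arguments simplex R X : clear implicits.

Definition full_support (R : realType) (X : finType) (p : {ffun X -> R}) : Prop :=
  forall x, 0 < p x.

(* Cross-entropy and KL divergence are real-valued here, which is their usual
   value whenever the second argument [p] has full support; the value +oo that
   arises when [q x > 0 = p x] for some [x] is not modelled.  The convention
   0 log 0 = 0 holds since the corresponding summands are products by 0. *)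
Definition cross_entropy (R : realType) (X : finType) (q p : {ffun X -> R}) : R :=
  - \sum_x q x * ln (p x).

Definition KL_div (R : realType) (X : finType) (q p : {ffun X -> R}) : R :=
  \sum_x q x * ln (q x / p x).

Definition argmin (R : realType) (T : Type) (D : set T) (f : T -> R) : set T :=
  [set q | D q /\ forall q', D q' -> f q <= f q'].

(* Main.v *)
(* Gibbs' variational principle: on the simplex the objective equals
   lambda * D_KL(q | g) plus a constant, where g is the normalisation of
   q_prev * p_pref `^ (1 / lambda).  Since ln y <= y - 1, with equality only at
   y = 1, the divergence is nonnegative and vanishes only at q = g. *)
Require Import Defs.
From HB Require Import structures.
From mathcomp Require Import all_boot all_order all_algebra.
From mathcomp Require Import all_classical all_reals all_analysis.
From mathcomp Require Import ring lra.

Set Implicit Arguments.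
Unset Strict Implicit.
Unset Printing Implicit Defensive.

Import Order.TTheory GRing.Theory Num.Theory.
Local Open Scope classical_set_scope.
Local Open Scope ring_scope.

(** This is the strict bound [1 + t < expR t] for [t != 0], taken at [t = ln y]. *)
Lemma lt_ln_sub1 (R : realType) (y : R) : 0 < y -> y != 1 -> ln y < y - 1.
Proof.
move=> y0 y1; have lny0 : ln y != 0 by rewrite ln_eq0.
by have := expR_gt1Dx lny0; rewrite lnK ?posrE// ltrBrDl.
Qed.

(** For [a > 0], multiply [ln y < y - 1] at [y = b / a] by [a] and change signs. For [a = 0] the
    right side is 0 and the left side is [- b]. *)
Lemma mul_ln_div_gt (R : realType) (a b : R) :
  0 <= a -> 0 < b -> a != b -> a - b < a * ln (a / b).
Proof.
rewrite le_eqVlt => /predU1P[<- b0 _|a0 b0 ab].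
  by rewrite mul0r sub0r oppr_lt0.
have ba1 : b / a != 1.
  by apply: contra ab => /eqP/divr1_eq ->.
have := lt_ln_sub1 (divr_gt0 b0 a0) ba1.
rewrite -(ltr_pM2l a0) mulrBr mulr1 mulrCA divff ?gt_eqF// mulr1.
rewrite -[b / a]invf_div lnV ?posrE ?divr_gt0// mulrN; lra.
Qed.

Lemma mul_ln_div_ge (R : realType) (a b : R) :
  0 <= a -> 0 < b -> a - b <= a * ln (a / b).
Proof.
move=> a0 b0; have [->|ab] := eqVneq a b; last exact/ltW/mul_ln_div_gt.
by rewrite subrr divff ?gt_eqF// ln1 mulr0.
Qed.

Section gibbs.
Context {R : realType} {X : finType}.
Implicit Types p q : {ffun X -> R}.

Lemma KL_div_self p : full_support p -> KL_div p p = 0.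
Proof. by move=> p0; apply: big1 => x _; rewrite divff ?gt_eqF// ln1 mulr0. Qed.

Lemma sum_simplex_sub p q : simplex R X p -> simplex R X q ->
  \sum_x (q x - p x) = 0.
Proof. by case=> _ p1 [_ q1]; rewrite sumrB p1 q1 subrr. Qed.

(** Each summand is at least [q x - p x], and these differences sum to 0. *)
Lemma KL_div_ge0 p q : simplex R X p -> simplex R X q -> full_support p ->
  0 <= KL_div q p.
Proof.
move=> ps qs p0; rewrite -(sum_simplex_sub ps qs).
by apply: ler_sum => x _; apply: mul_ln_div_ge; [exact: qs.1|exact: p0].
Qed.

(** The gaps in the termwise bound are nonnegative and sum to 0, so each one vanishes; strictness of
    the bound then rules out [q x != p x]. *)
Lemma KL_div_eq0 p q : simplex R X p -> simplex R X q -> full_support p ->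
  KL_div q p = 0 -> q = p.
Proof.
move=> ps qs p0 kl0; apply/ffunP => x.
have term_ge0 y : 0 <= q y * ln (q y / p y) - (q y - p y).
  by rewrite subr_ge0; apply: mul_ln_div_ge; [exact: qs.1|exact: p0].
have sum0 : \sum_y (q y * ln (q y / p y) - (q y - p y)) = 0.
  by rewrite sumrB (sum_simplex_sub ps qs) subr0.
apply/eqP; apply: contraT => /(mul_ln_div_gt (qs.1 x) (p0 x)).
by rewrite -subr_gt0 (psumr_eq0P (fun y _ => term_ge0 y) sum0) ?ltxx.
Qed.

Variables (r p : {ffun X -> R}) (lambda : R).

Definition gibbs_weight x := r x * p x `^ (1 / lambda).
Definition gibbs_sum := \sum_x gibbs_weight x.
Definition gibbs : {ffun X -> R} := [ffun x => gibbs_weight x / gibbs_sum].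

Hypotheses (r_simplex : simplex R X r) (r_supp : full_support r).
Hypotheses (p_supp : full_support p) (lambda_gt0 : 0 < lambda).

Lemma gibbs_weight_gt0 x : 0 < gibbs_weight x.
Proof. by rewrite mulr_gt0 ?powR_gt0. Qed.

Lemma gibbs_sum_gt0 : 0 < gibbs_sum.
Proof.
(* Over an empty [X] the total mass of [r] would be 0 instead of 1. *)
have [x _] : exists x : X, True.
  apply/not_existsP => X0; case: r_simplex => _ /eqP.
  by rewrite big1 => [|x _]; [rewrite eq_sym oner_eq0|case: (X0 x)].
rewrite /gibbs_sum (bigD1 x)//= ltr_wpDr ?gibbs_weight_gt0//.
by apply: sumr_ge0 => y _; exact/ltW/gibbs_weight_gt0.
Qed.

Lemma gibbs_full_support : full_support gibbs.
Proof. by move=> x; rewrite ffunE divr_gt0 ?gibbs_weight_gt0 ?gibbs_sum_gt0. Qed.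

Lemma gibbs_simplex : simplex R X gibbs.
Proof.
split=> [x|]; first exact/ltW/gibbs_full_support.
under eq_bigr do rewrite ffunE.
by rewrite -mulr_suml divff// gt_eqF ?gibbs_sum_gt0.
Qed.

(** Taking logarithms, [lambda * ln (gibbs x)] equals [lambda * ln (r x) + ln (p x) - lambda * ln
    gibbs_sum]. *)
Lemma objective_gibbs q : simplex R X q ->
  cross_entropy q p + lambda * KL_div q r =
  lambda * KL_div q gibbs - lambda * ln gibbs_sum.
Proof.
(* Writing the constant as [(\sum_x q x) * ln gibbs_sum] reduces the identity to one between
   summands. *)
move=> [q0 q1]; rewrite -[ln gibbs_sum]mul1r -q1 mulr_suml.
rewrite /cross_entropy /KL_div -sumrN !mulr_sumr -sumrN -!big_split/=.
apply: eq_bigr => x _; have := q0 x.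
(* Splitting the logarithm of a quotient requires [q x > 0]; when [q x = 0], all terms vanish. *)
rewrite le_eqVlt => /predU1P[<-|qx0]; first by rewrite !mul0r !mulr0 oppr0.
have [r0 p0] := (r_supp x, p_supp x).
have [Z0 w0] := (gibbs_sum_gt0, gibbs_weight_gt0 x).
rewrite ffunE !ln_div ?posrE ?divr_gt0//.
rewrite /gibbs_weight lnM ?posrE ?powR_gt0// ln_powR.
by field; rewrite gt_eqF.
Qed.

End gibbs.

Theorem theorem2 (R : realType) (X : finType)
    (q_prev p_pref : {ffun X -> R}) (lambda : R)
    (q_prev_simplex : simplex R X q_prev)
    (p_pref_simplex : simplex R X p_pref)
    (q_prev_supp : full_support q_prev)
    (p_pref_supp : full_support p_pref)
    (lambda_gt0 : 0 < lambda) (q_star : {ffun X -> R}) :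
  argmin (simplex R X)
    (fun q => cross_entropy q p_pref + lambda * KL_div q q_prev) q_star
  <->
  forall x, q_star x = (q_prev x * p_pref x `^ (1 / lambda))
                       / (\sum_y q_prev y * p_pref y `^ (1 / lambda)).
Proof.
pose g := gibbs q_prev p_pref lambda.
have gs : simplex R X g by exact: gibbs_simplex.
have g0 : full_support g by exact: gibbs_full_support.
have objE q : simplex R X q -> _ := objective_gibbs q_prev_simplex
  q_prev_supp p_pref_supp lambda_gt0 (q := q).
split=> [[qs qmin] x|q_starE].
  suff -> : q_star = g by rewrite ffunE.
  (* Comparing [q_star] with the competitor [g] cancels the constant and leaves
     [KL_div q_star g <= KL_div g g = 0]. *)
  apply: KL_div_eq0 => //; apply/eqP; rewrite eq_le KL_div_ge0// andbT.
  by have := qmin _ gs; rewrite !objE// lerD2r ler_pM2l// KL_div_self.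
have -> : q_star = g by apply/ffunP => x; rewrite ffunE q_starE.
split=> // q qs.
by rewrite !objE// lerD2r ler_pM2l// KL_div_self// KL_div_ge0.
Qed.
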